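(* For each $n\ge1$ and each type $i\in\{I,II,III\}$, let $c_n$ be the number of elements labeled $c$ (edges and loops) in a dimer covering of type $i$ of the Schreier graph $\Sigma_n$ of the Hanoi Towers group, chosen uniformly at random among all dimer coverings of type $i$. Let $\mu_{n,i}$ and $\sigma^2_{n,i}$ denote its mean and variance. Then $$\mu_{n,I}=\frac{3^{n-1}+1}{2},\quad \mu_{n,II}=\frac{3^{n-1}+3}{2},\quad \mu_{n,III}=\frac{3^{n-1}-1}{2},$$ $$\sigma^2_{n,I}=\frac{3^n-6n+3}{4},\quad\sigma^2_{n,II}=\frac{3^n+10n-13}{4},\quad \sigma^2_{n,III}=\frac{3^n-2n-1}{4}.$$
   Context: The Hanoi Towers group is generated by $a,b,c$ acting on ternary words, defined recursively for any ternary word $w$ by - $a(0w)=1w$, $a(1w)=0w$, $a(2w)=2a(w)$; - $b(0w)=2w$, $b(2w)=0w$, $b(1w)=1b(w)$; - $c(1w)=2w$, $c(2w)=1w$, $c(0w)=0c(w)$. $\Sigma_n$ has vertex set $\{0,1,2\}^n$, one edge labeled $s$ for each unordered pair $\{u,s(u)\}$ with $s(u)\ne u$, and loops labeled $c$ at $0^n$, $b$ at $1^n$, and $a$ at $2^n$. A dimer covering is a set of edges, loops allowed, covering each vertex exactly once (a loop covers its vertex). A covering is of - type I if it contains all three loops; - type II if it contains only the loop at $0^n$; - type III if it contains only the loop at $1^n$. In counting $c_n$, the loop at $0^n$, which is labeled $c$, counts as an element labeled $c$. *)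

(* Defs.v *)
From HB Require Import structures.
From mathcomp Require Import all_boot all_order all_algebra.

Set Implicit Arguments.
Unset Strict Implicit.
Unset Printing Implicit Defensive.

Import GRing.Theory Num.Theory.

Definition l0 : 'I_3 := @Ordinal 3 0 isT.
Definition l1 : 'I_3 := @Ordinal 3 1 isT.
Definition l2 : 'I_3 := @Ordinal 3 2 isT.

Inductive gen : Set := Ga | Gb | Gc.

Definition ord_of_gen (s : gen) : 'I_3 :=
  match s with Ga => l0 | Gb => l1 | Gc => l2 end.
Definition gen_of_ord (i : 'I_3) : gen :=
  if i == l0 then Ga else if i == l1 then Gb else Gc.

Lemma ord_of_genK : cancel ord_of_gen gen_of_ord.
Proof. by case. Qed.

HB.instance Definition _ := Countable.copy gen (can_type ord_of_genK).
HB.instance Definition _ : isFinite gen := CanIsFinite ord_of_genK.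

(* The leftmost letter of a word is the head of the list. *)
Fixpoint hanoi_a (w : seq 'I_3) : seq 'I_3 :=
  if w is x :: v then
    if x == l0 then l1 :: v
    else if x == l1 then l0 :: v
    else l2 :: hanoi_a v
  else [::].

Fixpoint hanoi_b (w : seq 'I_3) : seq 'I_3 :=
  if w is x :: v then
    if x == l0 then l2 :: v
    else if x == l2 then l0 :: v
    else l1 :: hanoi_b v
  else [::].

Fixpoint hanoi_c (w : seq 'I_3) : seq 'I_3 :=
  if w is x :: v then
    if x == l1 then l2 :: v
    else if x == l2 then l1 :: v
    else l0 :: hanoi_c v
  else [::].

Definition hanoi (s : gen) : seq 'I_3 -> seq 'I_3 :=
  match s with Ga => hanoi_a | Gb => hanoi_b | Gc => hanoi_c end.

Lemma size_hanoi (s : gen) (w : seq 'I_3) : size (hanoi s w) = size w.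
Proof.
by case: s; elim: w => //= x v IHv; do 2!case: ifP => //= _; rewrite IHv.
Qed.

Notation word n := (n.-tuple 'I_3).

Lemma hanoi_tupleP (n : nat) (s : gen) (w : word n) : size (hanoi s w) == n.
Proof. by rewrite size_hanoi size_tuple. Qed.

Definition act (n : nat) (s : gen) (w : word n) : word n :=
  Tuple (hanoi_tupleP s w).

(* An edge is a label together with its set of endpoints, which is a
   singleton exactly when the edge is a loop. *)
Notation ledge n := (gen * {set word n})%type.

Definition loop0 (n : nat) : ledge n := (Gc, [set [tuple of nseq n l0]]).
Definition loop1 (n : nat) : ledge n := (Gb, [set [tuple of nseq n l1]]).
Definition loop2 (n : nat) : ledge n := (Ga, [set [tuple of nseq n l2]]).

Definition Sigma_edges (n : nat) : {set ledge n} :=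
  [set (s, [set u; act s u]) | s in [set: gen], u in [set: word n] & act s u != u]
    :|: [set loop0 n; loop1 n; loop2 n].

Definition is_dimer_covering (n : nat) (M : {set ledge n}) : bool :=
  (M \subset Sigma_edges n)
    && [forall v : word n, #|[set e in M | v \in e.2]| == 1].

Inductive covering_type : Set := TypeI | TypeII | TypeIII.

Definition has_type (n : nat) (i : covering_type) (M : {set ledge n}) : bool :=
  match i with
  | TypeI => [&& loop0 n \in M, loop1 n \in M & loop2 n \in M]
  | TypeII => [&& loop0 n \in M, loop1 n \notin M & loop2 n \notin M]
  | TypeIII => [&& loop0 n \notin M, loop1 n \in M & loop2 n \notin M]
  end.

Definition coverings (n : nat) (i : covering_type) : {set {set ledge n}} :=
  [set M | is_dimer_covering M && has_type i M].

Definition count_c (n : nat) (M : {set ledge n}) : nat :=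
  #|[set e in M | e.1 == Gc]|.

Local Open Scope ring_scope.

(* Mean and variance of X under the uniform distribution on S; both are 0
   by convention when S is empty. *)
Definition unif_mean (T : finType) (S : {set T}) (X : T -> rat) : rat :=
  (\sum_(x in S) X x) / #|S|%:R.

Definition unif_var (T : finType) (S : {set T}) (X : T -> rat) : rat :=
  unif_mean S (fun x => (X x - unif_mean S X) ^+ 2).

Definition mu (n : nat) (i : covering_type) : rat :=
  unif_mean (coverings n i) (fun M => (count_c M)%:R).

Definition sigma2 (n : nat) (i : covering_type) : rat :=
  unif_var (coverings n i) (fun M => (count_c M)%:R).

(* Main.v *)
(* A dimer covering amounts to a labelling f of the vertices by generators with
   f(f(v) v) = f(v).  Cutting words at their last letter splits Sigma_(n+1) into
   three copies of Sigma_n.  Of their three loops labelled s, the one in the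
   copy whose last letter is fixed by s remains a loop of Sigma_(n+1), and the
   other two are replaced by an edge labelled s.  A labelling of Sigma_(n+1) is thus a triple of
   labellings of Sigma_n that agree on which of these three edges are used.
   Let k be the number of vertices labelled c, so that k = 2 c_n, minus 1 if the
   loop at 0^n is used.  Since k is additive over the copies, its generating
   functions A, B, C, D (all loops used, only the loop at 0^n, at 1^n,
   at 2^n) satisfy
     A' = A^3 + BCD,  B' = B^3 + ACD,  C' = C^3 + ABD,  D' = D^3 + ABC,
   while an even number of used loops is impossible.  Hence the four types are
   equinumerous at each level, each branch of the recursion has probability 1/2,
   and means and variances follow by induction. *)
Require Import Defs.
From mathcomp Require Import all_boot all_order all_algebra.
From mathcomp Require Import ring.

Set Implicit Arguments.
Unset Strict Implicit.
Unset Printing Implicit Defensive.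

Import GRing.Theory Num.Theory.

(** * Action of the generators on words and their fixed words *)

Definition fixed_letter (s : gen) : 'I_3 :=
  match s with Ga => l2 | Gb => l1 | Gc => l0 end.

Definition swap (s : gen) (x : 'I_3) : 'I_3 := head x (hanoi s [:: x]).

Definition corner (n : nat) (s : gen) : word n :=
  [tuple of nseq n (fixed_letter s)].

Lemma hanoiK (s : gen) : involutive (hanoi s).
Proof.
by case: s; elim=> //= x v IH; case: x => [[|[|[|]]]] //= h;
  rewrite ?IH //; congr (_ :: _); apply: val_inj.
Qed.

Lemma hanoi_fixed (s : gen) (v : seq 'I_3) :
  (hanoi s v == v) = (v == nseq (size v) (fixed_letter s)).
Proof.
by case: s; elim: v => //= x v IH; case: x => [[|[|[|]]]] //= h;
  rewrite !eqseq_cons ?IH.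
Qed.

(** The recursion moves past a letter only if that letter is fixed by [s], so the last letter is
    reached exactly when all earlier ones are [fixed_letter s]. *)
Lemma hanoi_rcons (s : gen) (v : seq 'I_3) (x : 'I_3) :
  hanoi s (rcons v x) =
  if v == nseq (size v) (fixed_letter s) then rcons v (swap s x)
  else rcons (hanoi s v) x.
Proof.
elim: v => [|y v IH].
  by rewrite /= /swap; case: s => /=; do 2!case: ifP => //.
by move: IH; case: s; case: y => [[|[|[|]]]] //= h ->;
  rewrite eqseq_cons //=; case: ifP => //= _; congr (_ :: _); apply: val_inj.
Qed.

Lemma actK (n : nat) (s : gen) : involutive (@act n s).
Proof. by move=> v; apply/val_inj/hanoiK. Qed.

Lemma act_fixed (n : nat) (s : gen) (v : word n) :
  (act s v == v) = (v == corner n s).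
Proof. by rewrite -!val_eqE /= hanoi_fixed size_tuple. Qed.

Lemma act_corner (n : nat) (s : gen) : act s (corner n s) = corner n s.
Proof. by apply/eqP; rewrite act_fixed. Qed.

Lemma act_rcons (n : nat) (s : gen) (v : word n) (x : 'I_3) :
  act s [tuple of rcons v x] =
  if v == corner n s then [tuple of rcons v (swap s x)]
  else [tuple of rcons (act s v) x].
Proof.
by apply: val_inj; rewrite /= hanoi_rcons size_tuple -val_eqE /=; case: ifP.
Qed.

(** * Dimer coverings as vertex labellings *)

Section Coverings.

Variable n : nat.
Implicit Types (f : {ffun word n -> gen}) (M : {set ledge n}) (u v : word n).

(** At [corner n s] the two endpoints coincide, so loops need no separate treatment. *)
Definition edge (s : gen) v : ledge n := (s, [set v; act s v]).

Lemma edge_act (s : gen) v : edge s (act s v) = edge s v.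
Proof. by rewrite /edge actK setUC. Qed.

Lemma edge_corner (s : gen) : edge s (corner n s) = (s, [set corner n s]).
Proof. by rewrite /edge act_corner setUid. Qed.

Lemma edge_Sigma (s : gen) v : edge s v \in Sigma_edges n.
Proof.
rewrite inE; have [vfix|vmove] := boolP (act s v == v).
  have /eqP-> : v == corner n s by rewrite -act_fixed.
  rewrite edge_corner; apply/orP; right.
  by rewrite /loop0 /loop1 /loop2; case: s {v vfix}; rewrite !inE eqxx ?orbT.
apply/orP; left; apply/imset2P; exists s v => //.
by rewrite !inE.
Qed.

Lemma SigmaP (e : ledge n) :
  reflect (exists s v, e = edge s v) (e \in Sigma_edges n).
Proof.
apply: (iffP idP) => [|[s [v ->]]]; last exact: edge_Sigma.
rewrite !inE => /orP[/imset2P[s v _ _ ->]|]; first by exists s, v.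
case/orP=> [/orP[]|] /eqP->.
- by exists Gc, (corner n Gc); rewrite edge_corner.
- by exists Gb, (corner n Gb); rewrite edge_corner.
- by exists Ga, (corner n Ga); rewrite edge_corner.
Qed.

Lemma edge_through (e : ledge n) v :
  e \in Sigma_edges n -> v \in e.2 -> e = edge e.1 v.
Proof.
by case/SigmaP=> s [u ->]; rewrite !inE => /orP[] /eqP-> //=; rewrite edge_act.
Qed.

Definition dimer_labelling f : bool := [forall v, f (act (f v) v) == f v].

Definition cover f : {set ledge n} := [set edge (f v) v | v : word n].

Definition hit (s : gen) f : bool := f (corner n s) == s.

(** The loops used, in the order of the vertices 0^n, 1^n, 2^n. *)
Definition pattern f : bool * bool * bool := (hit Gc f, hit Gb f, hit Ga f).

Definition weight f : nat := #|[set v | f v == Gc]|.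

Lemma cover_through f (e : ledge n) v :
  dimer_labelling f -> e \in cover f -> v \in e.2 -> e = edge (f v) v.
Proof.
move=> /forallP fP /imsetP[u _ ->]; rewrite !inE => /orP[] /eqP-> //.
by rewrite (eqP (fP u)) edge_act.
Qed.

Lemma mem_cover f (s : gen) v :
  dimer_labelling f -> (edge s v \in cover f) = (f v == s).
Proof.
move=> fP; apply/idP/eqP => [eM|<-]; last exact: imset_f.
have ve : v \in (edge s v).2 by rewrite !inE eqxx.
by have [] := cover_through fP eM ve.
Qed.

Lemma loop_cover f (s : gen) :
  dimer_labelling f -> ((s, [set corner n s]) \in cover f) = hit s f.
Proof. by move=> fP; rewrite -edge_corner mem_cover. Qed.

Lemma cover_dimer f : dimer_labelling f -> is_dimer_covering (cover f).
Proof.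
move=> fP; apply/andP; split.
  by apply/subsetP=> e /imsetP[v _ ->]; apply: edge_Sigma.
apply/forallP=> v; apply/cards1P; exists (edge (f v) v); apply/setP=> e.
rewrite !inE; apply/andP/eqP => [[eM ve]|->]; first exact: cover_through ve.
by rewrite mem_cover // !inE !eqxx.
Qed.

Lemma cover_inj : {in dimer_labelling &, injective cover}.
Proof.
move=> f g fP gP fg; apply/ffunP=> v.
by apply/esym/eqP; rewrite -mem_cover // -fg mem_cover.
Qed.

Lemma dimer_cover M :
  is_dimer_covering M -> exists2 f, dimer_labelling f & cover f = M.
Proof.
case/andP=> /subsetP subM /forallP uniM.
have exM v : exists s, edge s v \in M.
  have /cards1P[e eE] := uniM v; have: e \in [set e] by rewrite inE.
  rewrite -eE inE => /andP[eM ve]; exists e.1.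
  by rewrite -edge_through // subM.
pose f := [ffun v => xchoose (exM v)].
have fM v : edge (f v) v \in M by rewrite ffunE; apply: (xchooseP (exM v)).
have fE s v : edge s v \in M -> f v = s.
  move=> sM; have /cards1P[e eE] := uniM v.
  have: edge (f v) v \in [set e] by rewrite -eE !inE fM eqxx.
  have: edge s v \in [set e] by rewrite -eE !inE sM eqxx.
  by rewrite !inE => /eqP<- /eqP[].
exists f.
  (* The edge chosen at [v] also passes through [act (f v) v], where uniqueness forces the same
     label. *)
  by apply/forallP=> v; apply/eqP/fE; rewrite edge_act.
apply/setP=> e; apply/imsetP/idP => [[v _ ->]|eM] //.
have /SigmaP[s [v eE]] := subM e eM; exists v => //.
by rewrite eE (fE s) // -eE.
Qed.

(** Count pairs of a c-labelled element of the covering and one of its endpoints: an edge has two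
    endpoints, the loop only one. *)
Lemma weight_cover f : dimer_labelling f ->
  (count_c (cover f) * 2)%N = (weight f + hit Gc f)%N.
Proof.
move=> fP.
have -> : weight f = \sum_(e in [set e in cover f | e.1 == Gc]) #|e.2|.
  under eq_bigr do rewrite -sum1_card.
  rewrite (exchange_big_dep predT) //= /weight -sum1_card.
  rewrite [LHS]big_mkcond; apply: eq_bigr => v _.
  rewrite inE sum1_card; case: eqP => [fv|fv].
    apply/esym/(@eq_card1 _ (edge Gc v)) => e; rewrite unfold_in /= !inE.
    apply/andP/eqP => [[/andP[eM _] ve]|->].
      by rewrite -fv; apply: cover_through ve.
    by rewrite mem_cover // fv !inE !eqxx.
  apply/esym/eq_card0 => e; rewrite unfold_in /= !inE.
  apply/negP=> /andP[/andP[eM e1] ve]; apply: fv.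
  by move: e1; rewrite (cover_through fP eM ve) => /eqP.
rewrite /count_c -loop_cover // -sum1_card big_distrl /=.
set A := [set e in _ | _].
have -> : ((Gc, [set corner n Gc]) \in cover f) =
  ((Gc, [set corner n Gc]) \in A) by rewrite !inE andbT.
have hA e : e \in A -> (#|e.2| + (e == (Gc, [set corner n Gc])))%N = 2.
  rewrite inE => /andP[/imsetP[v _ ->] /= /eqP ->].
  rewrite -edge_corner cards2 eq_sym act_fixed.
  have [->|vc] := eqVneq v; first by rewrite eqxx.
  case: eqP => // -[vE]; have: v \in [set corner n Gc; act Gc (corner n Gc)].
    by rewrite -vE !inE eqxx.
  by rewrite act_corner setUid inE (negbTE vc).
have -> : ((Gc, [set corner n Gc]) \in A : nat) =
  \sum_(e in A) (e == (Gc, [set corner n Gc])).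
  case xA: (_ \in A).
    by rewrite (bigD1 _ xA) /= eqxx big1 // => e /andP[_ /negbTE->].
  by rewrite big1 // => e eA; case: eqP => // ex; rewrite -ex eA in xA.
rewrite -big_split; apply: eq_bigr => e eA.
by rewrite /= hA.
Qed.

End Coverings.

(** * Assembling level n+1 from three copies of level n *)

Section Gluing.

Variable n : nat.
Implicit Types (g : {ffun 'I_3 -> {ffun word n -> gen}}) (v : word n).

Definition body (w : word n.+1) : word n :=
  [tuple of belast (head l0 w) (behead w)].

Lemma body_rcons v x : body [tuple of rcons v x] = v.
Proof.
by apply: val_inj => /=; case: (tval v) => [|y u] //=; rewrite belast_rcons.
Qed.

Lemma rcons_body (w : word n.+1) : [tuple of rcons (body w) (last l0 w)] = w.
Proof. by case/tupleP: w => x t; apply: val_inj; rewrite /= -lastI. Qed.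

(** [g x] labels the copy formed by the words ending in [x]. *)
Definition glue g : {ffun word n.+1 -> gen} :=
  [ffun w : word n.+1 => g (last l0 w) (body w)].

Definition unglue (f : {ffun word n.+1 -> gen}) :
    {ffun 'I_3 -> {ffun word n -> gen}} :=
  [ffun x => [ffun v : word n => f [tuple of rcons v x]]].

Lemma glueE g v x : glue g [tuple of rcons v x] = g x v.
Proof. by rewrite ffunE body_rcons /= last_rcons. Qed.

Lemma glueK : cancel glue unglue.
Proof.
by move=> g; apply/ffunP=> x; apply/ffunP=> v; rewrite 2!ffunE glueE.
Qed.

Lemma unglueK : cancel unglue glue.
Proof.
by move=> f; apply/ffunP=> w; rewrite -(rcons_body w) glueE !ffunE.
Qed.

Lemma glue_bij : bijective glue.
Proof. by exists unglue; [apply: glueK | apply: unglueK]. Qed.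

Lemma corner_rcons (s : gen) :
  corner n.+1 s = [tuple of rcons (corner n s) (fixed_letter s)].
Proof.
apply: val_inj => /=; elim: n => //= k IH.
by rewrite -[in RHS]IH.
Qed.

Lemma hit_glue (s : gen) g : hit s (glue g) = hit s (g (fixed_letter s)).
Proof. by rewrite /hit corner_rcons glueE. Qed.

(** Away from its corners each copy keeps its own action. At the corner of [s], the action changes
    the last letter [x] into [swap s x], so the two copies must agree on using that edge. *)
Lemma dimer_labelling_glue g :
  dimer_labelling (glue g) =
  [forall x, dimer_labelling (g x)] &&
  [forall s, forall x, hit s (g (swap s x)) == hit s (g x)].
Proof.
have swapK s : involutive (swap s).
  by case: s; case=> [[|[|[|]]]] // i; apply: val_inj.
apply/forallP/andP => [gP|[/forallP gP /forallP linkP] w].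
  have gPr v x : glue g (act (g x v) [tuple of rcons v x]) = g x v.
    by have /eqP := gP [tuple of rcons v x]; rewrite glueE.
  split; apply/forallP.
    move=> x; apply/forallP=> v; have := gPr v x; rewrite act_rcons.
    case: ifP => [|_]; last by rewrite glueE => ->.
    by rewrite -act_fixed => /eqP->.
  move=> s.
  have linkW x : hit s (g x) -> hit s (g (swap s x)).
    move=> /eqP gx; have := gPr (corner n s) x.
    by rewrite gx act_rcons eqxx glueE /hit => ->.
  (* The converse implication is [linkW] at [swap s x], since [swap s] is an involution. *)
  apply/forallP=> x; apply/eqP; apply/idP/idP => [/linkW|/linkW //].
  by rewrite swapK.
rewrite -(rcons_body w); move: (body w) (last l0 w) => v x.
rewrite glueE act_rcons.
have [vE|_] := eqVneq v (corner n (g x v)); rewrite glueE; last first.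
  by have /forallP := gP x; apply.
have /forallP/(_ x) := linkP (g x v).
by rewrite /hit -vE eqxx eqb_id.
Qed.

Lemma weight_glue g : weight (glue g) = (\sum_x weight (g x))%N.
Proof.
rewrite /weight -sum1_card; under [RHS]eq_bigr do rewrite -sum1_card.
rewrite pair_big_dep /=.
rewrite (reindex (fun p : 'I_3 * word n => [tuple of rcons p.2 p.1])) /=.
  by apply: eq_bigl => -[x v]; rewrite !inE glueE.
exists (fun w : word n.+1 => (last l0 w, body w)) => [[x v]|w] _ /=.
  by rewrite body_rcons last_rcons.
exact: rcons_body.
Qed.

End Gluing.

(** * Generating functions and their recursion *)

Local Open Scope ring_scope.

Notation pat := (bool * bool * bool)%type.

Definition genf (n : nat) (p : pat) : {poly rat} :=
  \sum_(f : {ffun word n -> gen} | dimer_labelling f && (pattern f == p))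
    'X^(weight f).

(** In copy [x], the corner whose loop survives is governed by the outer pattern [p], the other two
    by the pattern [q] of connecting edges. *)
Definition copy_pattern (p q : pat) (x : 'I_3) : pat :=
  if x == l0 then (p.1.1, q.1.2, q.2)
  else if x == l1 then (q.1.1, p.1.2, q.2)
  else (q.1.1, q.1.2, p.2).

(** The connecting edges c, b, a join the copies 1-2, 0-2 and 0-1; each is read at one end. *)
Definition links (n : nat) (g : {ffun 'I_3 -> {ffun word n -> gen}}) : pat :=
  (hit Gc (g l1), hit Gb (g l0), hit Ga (g l0)).

Lemma forall_ord3 (P : 'I_3 -> Prop) :
  (forall x, P x) <-> [/\ P l0, P l1 & P l2].
Proof.
split=> [//|[P0 P1 P2] [[|[|[|]]] // h]].
- by rewrite (_ : Ordinal h = l0) //; apply: val_inj.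
- by rewrite (_ : Ordinal h = l1) //; apply: val_inj.
- by rewrite (_ : Ordinal h = l2) //; apply: val_inj.
Qed.

(** Once [p] and [q] are fixed, the conditions on the three copies are independent, so the sum over
    glued labellings factors. *)
Lemma glue_cond (n : nat) (g : {ffun 'I_3 -> {ffun word n -> gen}})
    (p q : pat) :
  (dimer_labelling (glue g) && (pattern (glue g) == p)) && (links g == q) =
  (g \in family (fun x => [pred f | dimer_labelling f &&
                                    (pattern f == copy_pattern p q x)])).
Proof.
case: p q => [[p0 p1] p2] [[qc qb] qa].
rewrite dimer_labelling_glue /pattern !hit_glue /links /=.
apply/idP/familyP.
  case/andP=> /andP[/andP[/forallP gP /forallP linkP] /eqP[<- <- <-]].
  case/eqP=> <- <- <-.
  have [/eqP la _ _] := (forall_ord3 _).1 (forallP (linkP Ga)).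
  have [/eqP lb _ _] := (forall_ord3 _).1 (forallP (linkP Gb)).
  have [_ /eqP lc _] := (forall_ord3 _).1 (forallP (linkP Gc)).
  apply/forall_ord3; rewrite /copy_pattern !inE /=.
  move: la lb lc; rewrite /swap /= => -> -> ->.
  by rewrite !gP !eqxx.
move/forall_ord3; rewrite /copy_pattern !inE /= => -[].
case/andP=> g0 /eqP[-> hb0 ha0] /andP[g1 /eqP[hc1 -> ha1]].
case/andP=> g2 /eqP[hc2 hb2 ->].
rewrite hb0 ha0 hc1 !eqxx !andbT; apply/andP; split.
  by apply/forallP/forall_ord3.
apply/forallP=> -[]; apply/forallP/forall_ord3; rewrite /swap /=.
- by rewrite ha0 ha1 !eqxx.
- by rewrite hb0 hb2 !eqxx.
- by rewrite hc1 hc2 !eqxx.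
Qed.

Lemma genfS (n : nat) (p : pat) :
  genf n.+1 p = \sum_q \prod_x genf n (copy_pattern p q x).
Proof.
rewrite /genf (reindex (@glue n)) /=; last exact/onW_bij/glue_bij.
rewrite (partition_big (@links n) predT) //=; apply: eq_bigr => q _.
rewrite bigA_distr_big_dep /=; apply: eq_big => g; first exact: glue_cond.
by rewrite weight_glue expr_sum.
Qed.

Lemma genfSE (n : nat) (x y z : bool) :
  genf n.+1 (x, y, z) =
  \sum_(ga : bool) \sum_(be : bool) \sum_(al : bool)
    genf n (x, be, al) * genf n (ga, y, al) * genf n (ga, be, z).
Proof.
rewrite genfS pair_big /= pair_big /=; apply: eq_bigr => -[[ga be] al] _ /=.
by rewrite !big_ord_recl big_ord0 mulr1 mulrA.
Qed.

(** The empty word is fixed by all three generators, so its label alone decides which loop is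
    used. *)
Lemma genf0 (p : pat) :
  genf 0 p = if p is (true, false, false) then 'X
             else if p is (false, true, false) then 1
             else if p is (false, false, true) then 1 else 0.
Proof.
pose h x : {ffun word 0 -> gen} := [ffun=> gen_of_ord x].
have h_bij : bijective h.
  exists (fun f : {ffun word 0 -> gen} => ord_of_gen (f [tuple])) => [x|f].
    by rewrite ffunE; case: x => [[|[|[|]]]] // i; apply: val_inj.
  by apply/ffunP=> w; rewrite ffunE ord_of_genK (tuple0 w).
have hP x : dimer_labelling (h x) by apply/forallP=> w; rewrite !ffunE.
have hw x : weight (h x) = (gen_of_ord x == Gc).
  rewrite /weight; case: eqP => xc.
    by apply: (@eq_card1 _ [tuple]) => w; rewrite !inE ffunE (tuple0 w) xc eqxx.
  by apply: eq_card0 => w; rewrite inE ffunE; apply/eqP.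
rewrite /genf (reindex h) /=; last exact: onW_bij.
rewrite big_mkcond !big_ord_recl big_ord0 /= !hP !hw /pattern /hit !ffunE /=.
by case: p => [[[] []] []]; rewrite /= ?(addr0, add0r) ?expr0 ?expr1.
Qed.
(** In each term of [genfSE] every connecting bit occurs twice, so the three parities add up to that
    of [(x, y, z)]; if it is even, some factor has even pattern and vanishes. *)
Lemma genf_even (n : nat) (x y z : bool) :
  ~~ (x (+) y (+) z) -> genf n (x, y, z) = 0.
Proof.
elim: n x y z => [|n IH] x y z; first by rewrite genf0; case: x y z => [] [] [].
have E000 : genf n (false, false, false) = 0 by apply: IH.
have E110 : genf n (true, true, false) = 0 by apply: IH.
have E101 : genf n (true, false, true) = 0 by apply: IH.
have E011 : genf n (false, true, true) = 0 by apply: IH.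
by rewrite genfSE !big_bool; case: x y z => [] [] [] //= _;
  rewrite ?(E000, E110, E101, E011) ?(mul0r, mulr0, addr0).
Qed.

Section Recursion.

Variable n : nat.
Let A := genf n (true, true, true).
Let B := genf n (true, false, false).
Let C := genf n (false, true, false).
Let D := genf n (false, false, true).

(** Of the eight connecting patterns, only two complementary ones make all three factors odd. *)
Lemma genf_recursion :
  [/\ genf n.+1 (true, true, true) = A * A * A + B * C * D,
      genf n.+1 (true, false, false) = B * B * B + A * D * C,
      genf n.+1 (false, true, false) = D * A * B + C * C * C
    & genf n.+1 (false, false, true) = C * B * A + D * D * D].
Proof.
have E000 : genf n (false, false, false) = 0 by apply: genf_even.
have E110 : genf n (true, true, false) = 0 by apply: genf_even.
have E101 : genf n (true, false, true) = 0 by apply: genf_even.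
have E011 : genf n (false, true, true) = 0 by apply: genf_even.
rewrite /A /B /C /D; split; rewrite genfSE !big_bool /=;
  rewrite ?(E000, E110, E101, E011) ?(mul0r, mulr0, addr0, add0r) //.
Qed.

End Recursion.

(** * Means and variances from derivatives at 1 *)

(* [P] is [N] times the probability generating function of a distribution of
   mean [m] and variance [v]. *)
Definition has_moments (N m v : rat) (P : {poly rat}) : Prop :=
  [/\ P.[1] = N, P^`().[1] = N * m
    & P^`()^`().[1] = N * (v + m ^+ 2 - m)].

(** A product corresponds to a sum of independent variables. *)
Lemma has_moments_mul (N1 m1 v1 N2 m2 v2 : rat) (P Q : {poly rat}) :
  has_moments N1 m1 v1 P -> has_moments N2 m2 v2 Q ->
  has_moments (N1 * N2) (m1 + m2) (v1 + v2) (P * Q).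
Proof.
move=> [P0 P1 P2] [Q0 Q1 Q2].
by split; rewrite ?(derivM, derivD, hornerE) /= ?(P0, P1, P2, Q0, Q1, Q2); ring.
Qed.

(** Equal masses [N] give a mixture with weights 1/2; the variance follows the law of total
    variance. *)
Lemma has_moments_add (N m1 v1 m2 v2 : rat) (P Q : {poly rat}) :
  has_moments N m1 v1 P -> has_moments N m2 v2 Q ->
  has_moments (2 * N) ((m1 + m2) / 2) ((v1 + v2) / 2 + ((m1 - m2) / 2) ^+ 2)
    (P + Q).
Proof.
move=> [P0 P1 P2] [Q0 Q1 Q2].
by split; rewrite ?(derivD, hornerE) /= ?(P0, P1, P2, Q0, Q1, Q2); field.
Qed.

Lemma has_moments_branch (N m1 v1 m2 v2 m3 v3 m4 v4 m5 v5 m6 v6 m v : rat)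
    (P1 P2 P3 P4 P5 P6 : {poly rat}) :
  has_moments N m1 v1 P1 -> has_moments N m2 v2 P2 -> has_moments N m3 v3 P3 ->
  has_moments N m4 v4 P4 -> has_moments N m5 v5 P5 -> has_moments N m6 v6 P6 ->
  m = (m1 + m2 + m3 + (m4 + m5 + m6)) / 2 ->
  v = (v1 + v2 + v3 + (v4 + v5 + v6)) / 2
      + ((m1 + m2 + m3 - (m4 + m5 + m6)) / 2) ^+ 2 ->
  has_moments (2 * (N * N * N)) m v (P1 * P2 * P3 + P4 * P5 * P6).
Proof.
move=> h1 h2 h3 h4 h5 h6 -> ->; apply: has_moments_add.
  exact/has_moments_mul/h3/has_moments_mul.
exact/has_moments_mul/h6/has_moments_mul.
Qed.

(** These are the moments of [weight]. The induction starts at level 1, because at level 0 the first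
    generating function is zero and the masses differ. *)
Lemma genf_moments (n : nat) : exists2 N : rat, N != 0 &
  [/\ has_moments N (3 ^+ n) (3 ^+ n.+1 - 6 * n.+1%:R + 3)
        (genf n.+1 (true, true, true)),
      has_moments N (3 ^+ n + 2) (3 ^+ n.+1 + 10 * n.+1%:R - 13)
        (genf n.+1 (true, false, false)),
      has_moments N (3 ^+ n - 1) (3 ^+ n.+1 - 2 * n.+1%:R - 1)
        (genf n.+1 (false, true, false))
    & has_moments N (3 ^+ n - 1) (3 ^+ n.+1 - 2 * n.+1%:R - 1)
        (genf n.+1 (false, false, true))].
Proof.
elim: n => [|n [N N0 [hA hB hC hD]]].
  (* At level 1 the four polynomials are X, X^3, 1 and 1. *)
  exists 1 => //; have [-> -> -> ->] := genf_recursion 0.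
  rewrite !genf0 ?(mul0r, mulr0, mul1r, mulr1, addr0, add0r).
  by split; split; rewrite !(derivM, derivD, derivX, derivC, hornerE).
exists (2 * (N * N * N)); first by rewrite !mulf_neq0.
have [-> -> -> ->] := genf_recursion n.+1.
(* The means of the two branches differ by 0, 8, 4 and 4 respectively, which adds 0, 16, 4 and 4 to
   the averaged variances. *)
by split; (apply: has_moments_branch; [eassumption .. | |]);
  rewrite -?[n.+2%:R]natr1 -?[n.+1%:R]natr1 !exprS; field.
Qed.

(** * Transfer to uniformly random coverings *)

Definition type_pattern (i : covering_type) : pat :=
  match i with
  | TypeI => (true, true, true)
  | TypeII => (true, false, false)
  | TypeIII => (false, true, false)
  end.

Lemma coveringsE (n : nat) (i : covering_type) :
  coverings n i = [set cover f | f : {ffun word n -> gen}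
                    & dimer_labelling f && (pattern f == type_pattern i)].
Proof.
have typeE f : dimer_labelling f ->
    has_type i (@cover n f) = (pattern f == type_pattern i).
  move=> fP; have E s := loop_cover s fP; rewrite /pattern -!E.
  rewrite /has_type /loop0 /loop1 /loop2.
  by case: i; do 3!case: (_ \in _).
apply/setP=> M; rewrite inE; apply/andP/imsetP => [[dimM typM]|[f]].
  have [f fP fM] := dimer_cover dimM; exists f; last by [].
  by rewrite inE fP -typeE // fM.
rewrite inE => /andP[fP fi] ->; split; first exact: cover_dimer.
by rewrite typeE.
Qed.

(** A general [F] serves the cardinality, the mean and the variance alike. *)
Lemma coverings_sum (n : nat) (i : covering_type) (F : rat -> rat) :
  \sum_(M in coverings n i) F (count_c M)%:R =
  \sum_(f : {ffun word n -> gen}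
        | dimer_labelling f && (pattern f == type_pattern i))
    F (((weight f)%:R + (type_pattern i).1.1%:R) / 2).
Proof.
rewrite coveringsE big_imset /=; last first.
  by move=> f g; rewrite !inE => /andP[fP _] /andP[gP _]; apply: cover_inj.
apply: eq_big => f; first by rewrite inE.
rewrite inE => /andP[fP /eqP fi]; congr F.
have -> : (type_pattern i).1.1 = hit Gc f by rewrite -fi.
by rewrite -natrD -weight_cover // natrM mulfK.
Qed.

(** Within a type, the count is [(weight + e) / 2] with [e] constant, and [N] is the number of
    coverings. *)
Lemma mu_sigma2_of_moments (n : nat) (i : covering_type) (N m v : rat) :
  N != 0 -> has_moments N m v (genf n (type_pattern i)) ->
  [/\ coverings n i != set0, mu n i = (m + (type_pattern i).1.1%:R) / 2
    & sigma2 n i = v / 4].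
Proof.
set e : rat := (type_pattern i).1.1%:R => N0 [P0 P1 P2].
pose S := [pred f : {ffun word n -> gen} |
  dimer_labelling f && (pattern f == type_pattern i)].
have w0 : \sum_(f | S f) 1 = N.
  rewrite -P0 horner_sum; apply: eq_bigr => f _.
  by rewrite hornerXn expr1n.
have w1 : \sum_(f | S f) (weight f)%:R = N * m.
  rewrite -P1 /genf linear_sum horner_sum; apply: eq_bigr => f _.
  by rewrite /= derivXn hornerMn hornerXn expr1n.
have w2 : \sum_(f | S f) (weight f)%:R ^+ 2 = N * (v + m ^+ 2).
  (* The second moment is the second factorial moment plus the mean. *)
  have -> : N * (v + m ^+ 2) = N * (v + m ^+ 2 - m) + N * m by ring.
  rewrite -P2 -w1 /genf !linear_sum horner_sum -big_split.
  apply: eq_bigr => f _; rewrite /= derivXn derivMn derivXn !hornerMn hornerXn.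
  (* Weight 0 is separate because the exponent drop in the derivative is a truncated predecessor. *)
  rewrite expr1n; case: (weight f) => [|k]; first by rewrite expr0n addr0.
  by rewrite /= -mulr_natr -natr1; ring.
have cardE : #|coverings n i|%:R = N.
  by rewrite -w0 -(coverings_sum n i (fun=> 1)) sumr_const.
have muE : mu n i = (m + e) / 2.
  rewrite /mu /unif_mean cardE (coverings_sum n i id) -/e.
  rewrite -mulr_suml big_split /= w1.
  have -> : \sum_(f | S f) e = N * e.
    by rewrite -w0 mulr_suml; apply: eq_bigr => f _; rewrite mul1r.
  by field.
split=> //.
  by apply: contraNneq N0 => cov0; rewrite -cardE cov0 cards0.
rewrite /sigma2 /unif_var -/(mu n i) muE /unif_mean cardE.
rewrite (coverings_sum n i (fun x => (x - (m + e) / 2) ^+ 2)) -/e.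
transitivity ((\sum_(f | S f) (weight f)%:R ^+ 2
  - 2 * m * \sum_(f | S f) (weight f)%:R + m ^+ 2 * \sum_(f | S f) 1) / 4 / N).
  congr (_ / N); rewrite !mulr_sumr -sumrB -big_split mulr_suml /=.
  by apply: eq_bigr => f _; field.
by rewrite w0 w1 w2; field.
Qed.

Theorem theorem5p1 (n : nat) (hn : (1 <= n)%N) :
  (forall i : covering_type, coverings n i != set0) /\
  [/\ mu n TypeI = (3 ^+ (n - 1) + 1) / 2,
      mu n TypeII = (3 ^+ (n - 1) + 3) / 2
    & mu n TypeIII = (3 ^+ (n - 1) - 1) / 2] /\
  [/\ sigma2 n TypeI = (3 ^+ n - 6 * n%:R + 3) / 4,
      sigma2 n TypeII = (3 ^+ n + 10 * n%:R - 13) / 4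
    & sigma2 n TypeIII = (3 ^+ n - 2 * n%:R - 1) / 4].
Proof.
case: n hn => // n _; rewrite subn1 /=.
have [N N0 [hA hB hC _]] := genf_moments n.
have [covI muI sI] := mu_sigma2_of_moments (i := TypeI) N0 hA.
have [covII muII sII] := mu_sigma2_of_moments (i := TypeII) N0 hB.
have [covIII muIII sIII] := mu_sigma2_of_moments (i := TypeIII) N0 hC.
split; first by case.
rewrite muI muII muIII; split; split=> //=; congr (_ / 2); ring.
Qed.
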